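(* Let $\mathbb r,\mathbb s$ be nc rational functions over $\mathbb C$ in $x_1,\dots,x_g$. Then $$\mathbb r(X)^*\mathbb r(X)\le\mathbb s(X)^*\mathbb s(X)\qquad\text{for all } X\in\operatorname{dom}\mathbb r\cap\operatorname{dom}\mathbb s$$ if and only if there exists $\lambda\in\mathbb C$ with $|\lambda|\le1$ such that $\mathbb r=\lambda\mathbb s$.
   Context: Let $\mathbb C\langle x\rangle=\mathbb C\langle x_1,\dots,x_g\rangle$ be the free algebra of noncommutative (nc) polynomials. A nc rational expression is a syntactically valid combination of nc polynomials, the operations $+,\cdot,{}^{-1}$ and parentheses. An expression $r$ can be evaluated at $X\in M_n(\mathbb C)^g$ whenever all inverses appearing in $r$ exist at $X$; $\operatorname{dom}_n r$ is the set of such $X$ and $\operatorname{dom} r=\bigcup_n\operatorname{dom}_n r$. Expressions $r_1,r_2$ with nonempty domains are equivalent if $r_1(X)=r_2(X)$ for all $X\in\operatorname{dom} r_1\cap\operatorname{dom} r_2$. Nc rational functions are the equivalence classes; they form a skew field. For a nc rational function $\mathbb r$, $\operatorname{dom}_n\mathbb r$ is the union of $\operatorname{dom}_n r$ over all representatives $r$ of $\mathbb r$, $\operatorname{dom}\mathbb r=\bigcup_n\operatorname{dom}_n\mathbb r$, and $\mathbb r(X)$ is the value of any representative defined at $X$. The inequality $\le$ is the Loewner order on hermitian matrices, and $*$ is the conjugate transpose. *)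

(* Defs.v *)
From HB Require Import structures.
From mathcomp Require Export all_boot all_order all_algebra.
From mathcomp Require Export boolp classical_sets reals.
From mathcomp.real_closed Require Export complex.

Set Implicit Arguments.
Unset Strict Implicit.
Unset Printing Implicit Defensive.

Import Order.TTheory GRing.Theory Num.Theory.
Local Open Scope ring_scope.
Local Open Scope sesquilinear_scope.

Section NcRational.
Variables (C : numClosedFieldType) (g : nat).

(* Nc polynomials are themselves the inverse-free expressions in scalars and
   variables, so scalars and variables suffice as leaves; subtraction is
   multiplication by the scalar -1. *)
Inductive ncexpr : Type :=
| NcConst of C
| NcVar of 'I_g
| NcAdd of ncexpr & ncexpr
| NcMul of ncexpr & ncexpr
| NcInv of ncexpr.

Implicit Types (r s : ncexpr) (n : nat).

(* Matrices have size n.+1: over 0 x 0 matrices every expression, including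
   the inverse of 0, would be defined. [ncexpr_eval] is total, but meaningful
   only on [ncexpr_dom], since [invmx A = A] for singular [A]. *)
Fixpoint ncexpr_eval n (X : 'I_g -> 'M[C]_n.+1) r : 'M[C]_n.+1 :=
  match r with
  | NcConst c => c%:M
  | NcVar i => X i
  | NcAdd r1 r2 => ncexpr_eval X r1 + ncexpr_eval X r2
  | NcMul r1 r2 => ncexpr_eval X r1 *m ncexpr_eval X r2
  | NcInv r1 => invmx (ncexpr_eval X r1)
  end.

Fixpoint ncexpr_dom n (X : 'I_g -> 'M[C]_n.+1) r : bool :=
  match r with
  | NcConst _ | NcVar _ => true
  | NcAdd r1 r2 | NcMul r1 r2 => ncexpr_dom X r1 && ncexpr_dom X r2
  | NcInv r1 => ncexpr_dom X r1 && (ncexpr_eval X r1 \in unitmx)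
  end.

Definition nondegenerate r : Prop :=
  exists n (X : 'I_g -> 'M[C]_n.+1), ncexpr_dom X r.

Definition ncexpr_equiv r s : Prop :=
  forall n (X : 'I_g -> 'M[C]_n.+1),
    ncexpr_dom X r -> ncexpr_dom X s -> ncexpr_eval X r = ncexpr_eval X s.

Definition ncexpr_class r : set ncexpr :=
  [set s | nondegenerate s /\ ncexpr_equiv r s]%classic.

Record ncrat : Type := NcRat {
  ncrat_reps :> set ncexpr;
  ncrat_repsP : exists2 r, nondegenerate r & ncrat_reps = ncexpr_class r
}.

Definition ncrat_of r (hr : nondegenerate r) : ncrat :=
  @NcRat (ncexpr_class r) (ex_intro2 _ _ r hr erefl).

Definition ncrat_dom (f : ncrat) n (X : 'I_g -> 'M[C]_n.+1) : Prop :=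
  exists2 r, ncrat_reps f r & ncexpr_dom X r.

(* The common value at X of all representatives defined at X
   (0 outside the domain). *)
Definition ncrat_eval (f : ncrat) n (X : 'I_g -> 'M[C]_n.+1) : 'M[C]_n.+1 :=
  xget 0 [set A | exists r, [/\ ncrat_reps f r, ncexpr_dom X r
                             & A = ncexpr_eval X r]]%classic.

Definition ncrat_repr (f : ncrat) : ncexpr := s2val (cid2 (ncrat_repsP f)).

Lemma ncrat_repr_nondegenerate f : nondegenerate (ncrat_repr f).
Proof. exact: (s2valP (cid2 (ncrat_repsP f))). Qed.

Lemma ncrat_reprE f : ncrat_reps f = ncexpr_class (ncrat_repr f).
Proof. exact: (s2valP' (cid2 (ncrat_repsP f))). Qed.

Lemma nondegenerate_scale (a : C) r :
  nondegenerate r -> nondegenerate (NcMul (NcConst a) r).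
Proof. by case=> n [X Xr]; exists n, X. Qed.

(* The product of the scalar a and f in the skew field of nc rational
   functions, computed on a representative of f. *)
Definition ncrat_scale (a : C) (f : ncrat) : ncrat :=
  ncrat_of (nondegenerate_scale a (ncrat_repr_nondegenerate f)).

End NcRational.

Definition psdmx (C : numClosedFieldType) n (A : 'M[C]_n) : Prop :=
  A \is hermsymmx /\ forall v : 'cV[C]_n, 0 <= (v^t* *m A *m v) 0 0.

Definition loewner_le (C : numClosedFieldType) n (A B : 'M[C]_n) : Prop :=
  [/\ A \is hermsymmx, B \is hermsymmx & psdmx (B - A)].

(* Main.v *)
(* Replacing X by P X P^-1 in the hypothesis gives |P r(X) w| <= |P s(X) w| for
   every invertible P and every vector w, which forces r(X) w to be a multiple
   of s(X) w. Fix Y and v with s(Y) v <> 0. Applied to the direct sum of X and Y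
   and to the vector (w, v), this shows that the factor for (X, w) is the one
   for (Y, v), hence a constant lambda.

   Equality in the skew field then requires that equivalence of expressions is
   transitive, which is proved by restricting expressions to lines of matrices,
   where they become quotients of polynomials in one variable. *)
Require Import Defs.
From mathcomp Require Import ring.

Set Implicit Arguments.
Unset Strict Implicit.
Unset Printing Implicit Defensive.

Import Order.TTheory GRing.Theory Num.Theory.
Local Open Scope ring_scope.
Local Open Scope sesquilinear_scope.
Local Open Scope complex_scope.

(** * Squared norms and the Loewner order on Gram matrices *)

Section NormSquare.
Variable C : numClosedFieldType.

Lemma trmxC_mul m n p (A : 'M[C]_(m, n)) (B : 'M[C]_(n, p)) :
  (A *m B)^t* = B^t* *m A^t*.
Proof. by rewrite trmx_mul map_mxM. Qed.

Definition normsq n (v : 'cV[C]_n) : C := (v^t* *m v) 0 0.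

Lemma normsqE n (v : 'cV[C]_n) : normsq v = \sum_i `|v i 0| ^+ 2.
Proof.
by rewrite /normsq mxE; apply: eq_bigr => i _; rewrite !mxE normCKC.
Qed.

Lemma normsq_ge0 n (v : 'cV[C]_n) : 0 <= normsq v.
Proof. by rewrite normsqE sumr_ge0 // => i _; rewrite exprn_ge0. Qed.

Lemma normsq_eq0 n (v : 'cV[C]_n) : (normsq v == 0) = (v == 0).
Proof.
rewrite normsqE psumr_eq0 => [|i _]; last by rewrite exprn_ge0.
apply/allP/eqP => [v0 | -> i _] /=; last by rewrite mxE normr0 expr0n.
apply/colP => i; rewrite mxE; apply/eqP.
have /= := v0 i (mem_index_enum i); by rewrite sqrf_eq0 normr_eq0.
Qed.

Lemma normsqZ n a (v : 'cV[C]_n) : normsq (a *: v) = `|a| ^+ 2 * normsq v.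
Proof.
by rewrite !normsqE mulr_sumr; apply: eq_bigr => i _; rewrite mxE normrM exprMn.
Qed.

Lemma normsq_mulmx m n (A : 'M[C]_(m, n)) (v : 'cV[C]_n) :
  (v^t* *m (A^t* *m A) *m v) 0 0 = normsq (A *m v).
Proof. by rewrite /normsq trmxC_mul !mulmxA. Qed.

Lemma hermsymmx_gram m n (A : 'M[C]_(m, n)) : A^t* *m A \is hermsymmx.
Proof. by apply/is_hermitianmxP; rewrite expr0 scale1r trmxC_mul trmxCK. Qed.

(** The quadratic form of the difference of the two Gram matrices at [v] is
    [normsq (B *m v) - normsq (A *m v)]. *)
Lemma loewner_le_gram m n (A B : 'M[C]_(m, n)) :
  loewner_le (A^t* *m A) (B^t* *m B) <->
  forall v : 'cV[C]_n, normsq (A *m v) <= normsq (B *m v).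
Proof.
have quadE v : (v^t* *m (B^t* *m B - A^t* *m A) *m v) 0 0 =
    normsq (B *m v) - normsq (A *m v).
  by rewrite mulmxBr mulmxBl !mxE -!normsq_mulmx !mxE.
split=> [[_ _ [_ psd]] v | le_AB].
  by rewrite -subr_ge0 -quadE; apply: psd.
split; try exact: hermsymmx_gram.
split=> [|v]; last by rewrite quadE subr_ge0.
have /is_hermitianmxP hA := hermsymmx_gram A.
have /is_hermitianmxP hB := hermsymmx_gram B.
apply/is_hermitianmxP; rewrite !expr0 !scale1r in hA hB *.
by rewrite linearB /= map_mxB -hA -hB.
Qed.

(* If x is not a multiple of u, a functional l with l u = 0 and l x = 1 makes
   P = 1 + c x l fix u and stretch x by the factor 1 + c. *)
Lemma colinear_of_normsq_le n (x u : 'cV[C]_n) :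
  (forall P, P \in unitmx -> normsq (P *m x) <= normsq (P *m u)) ->
  exists a, x = a *: u.
Proof.
move=> le_xu; have [/sub_rVP[a /(congr1 trmx)] | ] := boolP (x^T <= u^T)%MS.
  by rewrite linearZ /= !trmxK => ->; exists a.
rewrite submxE => /matrix0Pn[i [j xj0]].
pose b := (x^T *m cokermx u^T) i j.
(* Every column of [cokermx u^T] is a functional that kills [u]. Column [j] takes the nonzero value
   [b] at [x]. *)
pose l : 'rV_n := b^-1 *: (col j (cokermx u^T))^T.
have lE (y : 'cV_n) : l *m y = (b^-1 * (y^T *m cokermx u^T) i j)%:M.
  rewrite (ord1 i) [LHS]mx11_scalar; congr _%:M; rewrite -scalemxAl mxE.
  by congr (_ * _); rewrite !mxE; apply: eq_bigr => k _; rewrite !mxE mulrC.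
have lu0 : l *m u = 0 by rewrite lE mulmx_coker mxE mulr0 raddf0.
have lx1 : l *m x = 1%:M by rewrite lE mulVf.
have x0 : x != 0 by apply: contraNneq xj0 => ->; rewrite trmx0 mul0mx mxE.
have nx_gt0 : 0 < normsq x by rewrite lt_def normsq_ge0 normsq_eq0 x0.
(* This [c] gives (1 + c)^2 |x|^2 >= (1 + c) |x|^2 = |u|^2 + |x|^2 > |u|^2, contradicting the
   hypothesis for [P]. *)
pose c := normsq u / normsq x.
have c_ge0 : 0 <= c by rewrite divr_ge0 ?normsq_ge0.
have c1_gt0 : 0 < 1 + c by rewrite ltr_wpDr.
pose P := 1%:M + c *: (x *m l).
have Pu : P *m u = u.
  by rewrite mulmxDl mul1mx -scalemxAl -mulmxA lu0 mulmx0 scaler0 addr0.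
have Px : P *m x = (1 + c) *: x.
  by rewrite mulmxDl mul1mx -scalemxAl -mulmxA lx1 mulmx1 scalerDl scale1r.
have P_unit : P \in unitmx.
  (* The inverse of a rank-one perturbation of the identity, from l x = 1. *)
  have PQ : P *m (1%:M - (c / (1 + c)) *: (x *m l)) = 1%:M.
    rewrite mulmxBr mulmx1 -scalemxAr mulmxA Px -scalemxAl scalerA divfK ?gt_eqF //.
    by rewrite /P addrK.
  by case: (mulmx1_unit PQ).
have := le_xu P P_unit; rewrite Px Pu normsqZ (ger0_norm (ltW c1_gt0)) => le_cu.
have : (1 + c) * normsq x <= normsq u.
  apply: le_trans le_cu; rewrite ler_wpM2r ?normsq_ge0 // expr2.
  by rewrite ler_peMl ?(ltW c1_gt0) // lerDl.
by rewrite mulrDl mul1r /c divfK ?gt_eqF // gerDr lt_geF.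
Qed.

End NormSquare.

(** * Evaluation under morphisms, conjugations, direct sums and inflations *)

Section Evaluation.
Variables (C : numClosedFieldType) (g : nat).
Implicit Types (r s : ncexpr C g).

Lemma invmx_morph (n N : nat) (phi : 'M[C]_n -> 'M[C]_N) (A : 'M[C]_n) :
    {morph phi : A B / A *m B} -> phi 1%:M = 1%:M -> A \in unitmx ->
  phi A \in unitmx /\ phi (invmx A) = invmx (phi A).
Proof.
move=> phiM phi1 uA.
have phiAV : phi A *m phi (invmx A) = 1%:M by rewrite -phiM mulmxV.
have [uphiA _] := mulmx1_unit phiAV; split=> //.
by rewrite -[LHS]mul1mx -(mulVmx uphiA) -mulmxA phiAV mulmx1.
Qed.

(** A unital algebra morphism commutes with all operations, and it preserves invertibility, hence
    definedness. It is applied to conjugations and to the two inflations. *)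
Lemma ncexpr_eval_morph (n N : nat) (phi : 'M[C]_n.+1 -> 'M[C]_N.+1)
    (X : 'I_g -> 'M[C]_n.+1) r :
    {morph phi : A B / A + B} -> {morph phi : A B / A *m B} ->
    (forall c, phi c%:M = c%:M) -> ncexpr_dom X r ->
  ncexpr_dom (phi \o X) r /\
  ncexpr_eval (phi \o X) r = phi (ncexpr_eval X r).
Proof.
move=> phiD phiM phic; elim: r => [c|i|r1 IH1 r2 IH2|r1 IH1 r2 IH2|r IH] //=.
- by case/andP=> /IH1[-> ->] /IH2[-> ->]; rewrite phiD.
- by case/andP=> /IH1[-> ->] /IH2[-> ->]; rewrite phiM.
- case/andP=> /IH[-> ->] uA.
  by have [-> ->] := invmx_morph phiM (phic 1) uA.
Qed.

Lemma ncexpr_eval_conj n (P : 'M[C]_n.+1) (X : 'I_g -> 'M[C]_n.+1) r :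
    P \in unitmx -> ncexpr_dom X r ->
  ncexpr_dom (fun i => P *m X i *m invmx P) r /\
  ncexpr_eval (fun i => P *m X i *m invmx P) r =
    P *m ncexpr_eval X r *m invmx P.
Proof.
move=> uP; apply: (@ncexpr_eval_morph _ _ (fun A => P *m A *m invmx P)).
- by move=> A B; rewrite mulmxDr mulmxDl.
- by move=> A B; rewrite !mulmxA mulmxKV.
- by move=> c; rewrite scalar_mxC mulmxK.
Qed.

(** The size [(n + m.+1).+1] is convertible to [n.+1 + m.+1] and exhibits the successor that
    evaluation requires. *)
Definition ncpoint_dsum n m (X : 'I_g -> 'M[C]_n.+1) (Y : 'I_g -> 'M[C]_m.+1) :
    'I_g -> 'M[C]_((n + m.+1).+1) :=
  fun i => block_mx (X i) 0 0 (Y i) : 'M_(n.+1 + m.+1).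

Lemma ncexpr_eval_dsum n m
    (X : 'I_g -> 'M[C]_n.+1) (Y : 'I_g -> 'M[C]_m.+1) r :
    ncexpr_dom X r -> ncexpr_dom Y r ->
  ncexpr_dom (ncpoint_dsum X Y) r /\
  ncexpr_eval (ncpoint_dsum X Y) r =
    block_mx (ncexpr_eval X r) 0 0 (ncexpr_eval Y r) :> 'M_(n.+1 + m.+1).
Proof.
elim: r => [c|i|r1 IH1 r2 IH2|r1 IH1 r2 IH2|r IH] //=.
- by split=> //; exact: scalar_mx_block.
- case/andP=> X1 X2 /andP[Y1 Y2]; have [-> ->] := IH1 X1 Y1.
  have [-> ->] := IH2 X2 Y2; split=> //.
  by have /= := @add_block_mx _ n.+1 m.+1 n.+1 m.+1 (ncexpr_eval X r1) 0 0
    (ncexpr_eval Y r1) (ncexpr_eval X r2) 0 0 (ncexpr_eval Y r2); rewrite !addr0.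
- case/andP=> X1 X2 /andP[Y1 Y2]; have [-> ->] := IH1 X1 Y1.
  have [-> ->] := IH2 X2 Y2; split=> //.
  have /= := @mulmx_block _ n.+1 m.+1 n.+1 m.+1 n.+1 m.+1 (ncexpr_eval X r1) 0 0
    (ncexpr_eval Y r1) (ncexpr_eval X r2) 0 0 (ncexpr_eval Y r2).
  by rewrite !mulmx0 !mul0mx !addr0 !add0r.
- case/andP=> X1 uX /andP[Y1 uY]; have [-> ->] := IH X1 Y1.
  have u : block_mx (ncexpr_eval X r) 0 0 (ncexpr_eval Y r) \in unitmx.
    by rewrite block_diag_mx_unit uX.
  by split=> //; exact: invmx_block_diag u.
Qed.

(** Right multiplication by [A] on matrices with [m.+1] rows inflates [A] to [m.+1] diagonal copies.
    Matrices act on row vectors here, so the order of products is kept. *)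
Lemma lin_mulmxr_morph m n :
  [/\ {morph @lin_mulmxr C m.+1 n n : A B / A + B},
      {morph @lin_mulmxr C m.+1 n n : A B / A *m B},
      forall c, @lin_mulmxr C m.+1 n n c%:M = c%:M
    & injective (@lin_mulmxr C m.+1 n n)].
Proof.
split=> [A B | A B | c | A B eqAB]; first exact: raddfD.
- apply/row_matrixP => i; rewrite !rowE -(vec_mxK (delta_mx 0 i)).
  by rewrite mulmxA !mul_vec_lin /= mulmxA.
- apply/row_matrixP => i; rewrite !rowE -(vec_mxK (delta_mx 0 i)).
  by rewrite mul_vec_lin /= !mul_mx_scalar linearZ.
apply/row_matrixP => i; rewrite !rowE.
(* Right multiplication by [A] sends the matrix unit at position (0, i) to a matrix whose row 0 is
   row [i] of [A]. *)
have := congr1 (fun M => row 0 (vec_mx (mxvec (delta_mx (@ord0 m) i) *m M))) eqAB.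
rewrite /= !mul_vec_lin /= !mxvecK !row_mul.
suff -> : row 0 (delta_mx (@ord0 m) i) = delta_mx 0 i :> 'rV[C]_n by [].
by apply/rowP => j; rewrite !mxE.
Qed.

(** Left multiplication reverses products in the row convention, and the transpose restores their
    order. This inflates from the other tensor factor, so that two points of different sizes reach
    the same size. *)
Lemma lin_mulmx_trmx_morph m n :
  [/\ {morph (fun A : 'M[C]_m => @lin_mulmx C m m n A^T) : A B / A + B},
      {morph (fun A : 'M[C]_m => @lin_mulmx C m m n A^T) : A B / A *m B}
    & forall c, @lin_mulmx C m m n (c%:M)^T = c%:M].
Proof.
split=> [A B | A B | c]; first by rewrite !raddfD.
- apply/row_matrixP => i; rewrite !rowE -(vec_mxK (delta_mx 0 i)).
  by rewrite mulmxA !mul_vec_lin /= mulmxA trmx_mul.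
- apply/row_matrixP => i; rewrite !rowE -(vec_mxK (delta_mx 0 i)).
  by rewrite mul_vec_lin /= tr_scalar_mx mul_mx_scalar mul_scalar_mx linearZ.
Qed.

(** * Expressions along polynomial paths of matrices *)

Definition ncpath_at n (Z : 'I_g -> 'M[{poly C}]_n.+1) (t : C) :
    'I_g -> 'M[C]_n.+1 :=
  fun i => map_mx (horner_eval t) (Z i).

(** Along the path the value is P/q with a scalar denominator [q], built by induction so that q(t)
    <> 0 also ensures definedness at [t]. *)
Lemma ncexpr_eval_path n (Z : 'I_g -> 'M[{poly C}]_n.+1) (t0 : C) r :
    ncexpr_dom (ncpath_at Z t0) r ->
  exists (q : {poly C}) (P : 'M[{poly C}]_n.+1), q.[t0] != 0 /\
    forall t, q.[t] != 0 -> ncexpr_dom (ncpath_at Z t) r /\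
      q.[t] *: ncexpr_eval (ncpath_at Z t) r = map_mx (horner_eval t) P.
Proof.
elim: r => [c|i|r1 IH1 r2 IH2|r1 IH1 r2 IH2|r IH] /=.
- move=> _; exists 1, (c%:P)%:M; split=> [|t _]; first by rewrite hornerC oner_neq0.
  by split=> //; rewrite hornerC scale1r map_scalar_mx /= /horner_eval hornerC.
- move=> _; exists 1, (Z i); split=> [|t _]; first by rewrite hornerC oner_neq0.
  by split=> //; rewrite hornerC scale1r.
- case/andP=> /IH1[q1 [P1 [q10 H1]]] /IH2[q2 [P2 [q20 H2]]].
  exists (q1 * q2), (q2 *: P1 + q1 *: P2); split=> [|t].
    by rewrite hornerM mulf_neq0.
  rewrite hornerM mulf_eq0 negb_or => /andP[/H1[-> E1] /H2[-> E2]]; split=> //.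
  rewrite map_mxD !map_mxZ -E1 -E2 /= /horner_eval !scalerA scalerDr.
  by rewrite [q2.[t] * _]mulrC.
- case/andP=> /IH1[q1 [P1 [q10 H1]]] /IH2[q2 [P2 [q20 H2]]].
  exists (q1 * q2), (P1 *m P2); split=> [|t].
    by rewrite hornerM mulf_neq0.
  rewrite hornerM mulf_eq0 negb_or => /andP[/H1[-> E1] /H2[-> E2]]; split=> //.
  by rewrite map_mxM -E1 -E2 -scalemxAl -scalemxAr scalerA.
- case/andP=> /IH[q [P [q0 H]]] u.
  (* The inverse of P/q is q adj(P) / det(P). The extra factor [q] in the denominator keeps the
     argument of the inverse defined. *)
  exists (q * \det P), (q ^+ 2 *: \adj P); split=> [|t].
    have [_ E] := H t0 q0; rewrite hornerM mulf_neq0 //.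
    rewrite -horner_evalE -det_map_mx -E detZ mulf_neq0 ?expf_neq0 //.
    by move: u; rewrite unitmxE unitfE.
  rewrite hornerM mulf_eq0 negb_or => /andP[qt dt]; have [-> E] := H t qt.
  rewrite -horner_evalE -det_map_mx -E detZ mulf_eq0 negb_or in dt.
  have {dt} /andP[_ dt] := dt.
  have uA : ncexpr_eval (ncpath_at Z t) r \in unitmx by rewrite unitmxE unitfE.
  have uqA : q.[t] *: ncexpr_eval (ncpath_at Z t) r \in unitmx.
    by rewrite unitmxE detZ unitfE mulf_neq0 ?expf_neq0.
  rewrite uA; split=> //; rewrite map_mxZ map_mx_adj -E.
  rewrite -[\adj _](mulmxK uqA) mul_adj_mx mul_scalar_mx invmxZ // !scalerA.
  congr (_ *: _); rewrite -[(\det P).[t]]horner_evalE -det_map_mx -E.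
  by rewrite /= /horner_eval horner_exp; field.
Qed.

(** The product [p * e] vanishes everywhere, so [p * e + 1] has no root. Over an algebraically
    closed field it is then constant, whence [p * e = 0]. *)
Lemma poly_eq0_off_roots (p e : {poly C}) :
  e != 0 -> (forall t, e.[t] != 0 -> p.[t] = 0) -> p = 0.
Proof.
move=> e0 p0; have pe0 t : (p * e).[t] = 0.
  by rewrite hornerM; have [->|/p0->] := eqVneq e.[t] 0; rewrite ?mulr0 ?mul0r.
have [/closed_rootP[t /rootP] | ] := boolP (size (p * e + 1%:P) != 1%N).
  by rewrite hornerD pe0 hornerC add0r => /eqP; rewrite oner_eq0.
rewrite negbK => /size_poly1P[c _ pe_c].
have peE : p * e = (c - 1)%:P by rewrite polyCB -pe_c addrK.
have := pe0 0; rewrite peE hornerC => c1; move: peE; rewrite c1 => /eqP.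
by rewrite mulf_eq0 (negPf e0) orbF => /eqP.
Qed.

(** * Equivalence of expressions *)

Lemma ncexpr_equiv_sym r s : ncexpr_equiv r s -> ncexpr_equiv s r.
Proof. by move=> rs n X Xs Xr; rewrite rs. Qed.

(* The middle expression may be undefined on the common domain of the outer
   two: a point X there and a point Y where s is defined are inflated to a
   common size and joined by a line, on which all three expressions are
   defined at all but finitely many points. *)
Lemma ncexpr_equiv_trans s r1 r2 :
  nondegenerate s -> ncexpr_equiv r1 s -> ncexpr_equiv s r2 ->
  ncexpr_equiv r1 r2.
Proof.
case=> m [Y Ys] r1s sr2 n X X1 X2.
have [fD fM fc f_inj] := lin_mulmxr_morph m n.+1.
have [hD hM hc] := lin_mulmx_trmx_morph m.+1 n.+1.
(* [N.+1] is convertible to [m.+1 * n.+1], the common size of both inflations. *)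
pose N := (n + m * n.+1)%N.
pose f : 'M[C]_n.+1 -> 'M[C]_N.+1 := @lin_mulmxr C m.+1 n.+1 n.+1.
pose h : 'M[C]_m.+1 -> 'M[C]_N.+1 := fun A => @lin_mulmx C m.+1 m.+1 n.+1 A^T.
have [fX1 E1] := @ncexpr_eval_morph n N f X r1 fD fM fc X1.
have [fX2 E2] := @ncexpr_eval_morph n N f X r2 fD fM fc X2.
have [hYs _] := @ncexpr_eval_morph m N h Y s hD hM hc Ys.
apply: f_inj; rewrite -[LHS]E1 -[RHS]E2.
pose Z i := map_mx polyC (f (X i)) + 'X *: map_mx polyC (h (Y i) - f (X i)).
have ZE t : ncpath_at Z t = fun i => f (X i) + t *: (h (Y i) - f (X i)).
  apply/funext => i; apply/matrixP => j k.
  by rewrite !mxE /horner_eval hornerD hornerM hornerX !hornerC.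
have Z0 : ncpath_at Z 0 = f \o X.
  by rewrite ZE; apply/funext => i /=; rewrite scale0r addr0.
have Z1 : ncpath_at Z 1 = h \o Y.
  by rewrite ZE; apply/funext => i /=; rewrite scale1r addrC subrK.
rewrite -Z0 in fX1 fX2 *; rewrite -Z1 in hYs.
have [q1 [P1 [q10 H1]]] := ncexpr_eval_path fX1.
have [q2 [P2 [q20 H2]]] := ncexpr_eval_path fX2.
have [q [P [q0 H]]] := ncexpr_eval_path hYs.
have nz (p : {poly C}) t : p.[t] != 0 -> p != 0.
  by apply: contraNneq => ->; rewrite horner0.
(* Off the roots of [q1 * q2 * q] all three expressions are defined and [s] links the outer two, so
   P1/q1 = P2/q2 as rational functions. *)
have P12 : q2 *: P1 = q1 *: P2.
  apply/matrixP => i j; apply/eqP; rewrite -subr_eq0; apply/eqP.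
  apply: (@poly_eq0_off_roots _ (q1 * q2 * q)) => [|t].
    by rewrite !mulf_neq0 ?(nz _ _ q10) ?(nz _ _ q20) ?(nz _ _ q0).
  rewrite !hornerM !mulf_eq0 !negb_or => /andP[/andP[/H1[D1 F1] /H2[D2 F2]]].
  move=> /H[Ds _].
  have: q2.[t] *: map_mx (horner_eval t) P1 = q1.[t] *: map_mx (horner_eval t) P2.
    by rewrite -F1 -F2 (r1s _ _ D1 Ds) (sr2 _ _ Ds D2) !scalerA mulrC.
  move/matrixP => /(_ i j); rewrite !mxE hornerD hornerN !hornerM /horner_eval.
  by move=> ->; rewrite subrr.
(* At t = 0 both denominators are nonzero, so the polynomial identity compares the values at [X]
   even if [s] is undefined there. *)
have [_ F1] := H1 0 q10; have [_ F2] := H2 0 q20.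
have q120 : q2.[0] * q1.[0] != 0 by rewrite mulf_neq0.
apply: (scalerI q120); rewrite -scalerA F1 mulrC -scalerA F2.
move/(congr1 (map_mx (horner_eval 0))): P12.
by rewrite !map_mxZ.
Qed.

Lemma ncexpr_equiv_scale a r s :
  ncexpr_equiv r s -> ncexpr_equiv (NcMul (NcConst g a) r) (NcMul (NcConst g a) s).
Proof. by move=> rs n X /= Xr Xs; rewrite (rs _ _ Xr Xs). Qed.

Lemma ncexpr_class_eq r s :
  nondegenerate r -> nondegenerate s -> ncexpr_equiv r s ->
  ncexpr_class r = ncexpr_class s.
Proof.
move=> r0 s0 rs; apply/seteqP; split=> t [t0 rt]; split=> //.
  exact: ncexpr_equiv_trans r0 (ncexpr_equiv_sym rs) rt.
exact: ncexpr_equiv_trans s0 rs rt.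
Qed.

(** * From norm inequalities to one constant factor *)

Lemma mulmx_cVP n (A B : 'M[C]_n) : (forall w : 'cV_n, A *m w = B *m w) -> A = B.
Proof.
move=> AB; apply: trmx_inj; apply/row_matrixP => j.
by rewrite -!tr_col !colE AB.
Qed.

Lemma ncexpr_normsq_le r s :
    (forall n (X : 'I_g -> 'M[C]_n.+1) w, ncexpr_dom X r -> ncexpr_dom X s ->
      normsq (ncexpr_eval X r *m w) <= normsq (ncexpr_eval X s *m w)) ->
  exists a : C, `|a| <= 1 /\ ncexpr_equiv r (NcMul (NcConst g a) s).
Proof.
move=> le_rs.
have pointwise n (X : 'I_g -> 'M[C]_n.+1) (w : 'cV_n.+1) :
    ncexpr_dom X r -> ncexpr_dom X s ->
  exists a, ncexpr_eval X r *m w = a *: (ncexpr_eval X s *m w).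
  move=> Xr Xs; apply: colinear_of_normsq_le => P uP.
  have [PXr Er] := ncexpr_eval_conj uP Xr.
  have [PXs Es] := ncexpr_eval_conj uP Xs.
  by have := le_rs _ _ (P *m w) PXr PXs; rewrite Er Es !mulmxA !mulmxKV.
have [[m [Y [v [Yr Ys sv0]]]] | s0] := pselect (exists m
    (Y : 'I_g -> 'M[C]_m.+1) (v : 'cV_m.+1),
    [/\ ncexpr_dom Y r, ncexpr_dom Y s & ncexpr_eval Y s *m v != 0]); last first.
  (* Here [s] vanishes on the whole common domain, hence so does [r]. *)
  exists 0; rewrite normr0 ler01; split=> // n X Xr Xs /=.
  apply: mulmx_cVP => w; have [a ->] := pointwise _ _ w Xr Xs.
  have [-> | sw0] := eqVneq (ncexpr_eval X s *m w) 0.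
    by rewrite -mulmxA scaler0 mul_scalar_mx scale0r.
  by case: s0; exists n, X, w; split.
have [a rv] := pointwise _ _ v Yr Ys.
have ns_gt0 : 0 < normsq (ncexpr_eval Y s *m v).
  by rewrite lt_def normsq_ge0 normsq_eq0 sv0.
exists a; split=> [|n X Xr /= Xs].
  have := le_rs _ _ v Yr Ys; rewrite rv normsqZ.
  by rewrite -[leRHS]mul1r ler_pM2r // expr_le1.
apply: mulmx_cVP => w; rewrite -mulmxA mul_scalar_mx.
have [XYr Er] := ncexpr_eval_dsum Xr Yr.
have [XYs Es] := ncexpr_eval_dsum Xs Ys.
have [b] := pointwise _ _ (col_mx w v : 'cV_(n.+1 + m.+1)) XYr XYs.
rewrite Er Es => Eb.
have := @mul_block_col _ n.+1 m.+1 n.+1 m.+1 1 (ncexpr_eval X r) 0 0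
  (ncexpr_eval Y r) w v.
have := @mul_block_col _ n.+1 m.+1 n.+1 m.+1 1 (ncexpr_eval X s) 0 0
  (ncexpr_eval Y s) w v.
rewrite !mul0mx !addr0 !add0r => Fs Fr.
have := etrans (esym Fr) (etrans Eb (congr1 (fun M => b *: M) Fs)).
(* The lower block reads a s(Y) v = b s(Y) v with s(Y) v <> 0, so b = a. The upper block is the
   claim with factor [b]. *)
rewrite scale_col_mx => /eq_col_mx[-> ]; rewrite rv => /eqP.
rewrite -subr_eq0 -scalerBl scaler_eq0 (negPf sv0) orbF subr_eq0.
by move=> /eqP ->.
Qed.

(** * Values of nc rational functions *)

Lemma ncrat_eq (f h : ncrat C g) : ncrat_reps f = ncrat_reps h -> f = h.
Proof.
case: f h => [A hA] [B hB] /= AB; rewrite {A}AB in hA *.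
by congr NcRat; exact: Prop_irrelevance.
Qed.

Lemma ncrat_repr_rep (f : ncrat C g) : ncrat_reps f (ncrat_repr f).
Proof.
by rewrite {1}ncrat_reprE; split=> //; exact: ncrat_repr_nondegenerate.
Qed.

(** Two representatives defined at [X] agree there by transitivity through [ncrat_repr f], which may
    itself be undefined at [X]. *)
Lemma ncrat_evalE (f : ncrat C g) n (X : 'I_g -> 'M[C]_n.+1) r :
  ncrat_reps f r -> ncexpr_dom X r -> ncrat_eval f X = ncexpr_eval X r.
Proof.
move=> fr Xr; rewrite /ncrat_eval.
set S := (X in xget _ X); have : S (xget 0 S).
  by apply: xgetPex; exists (ncexpr_eval X r), r.
case=> r' [fr' Xr' ->]; rewrite ncrat_reprE in fr fr'.
have [_ fr1] := fr; have [_ fr1'] := fr'.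
exact: (ncexpr_equiv_trans (ncrat_repr_nondegenerate f)
  (ncexpr_equiv_sym fr1') fr1).
Qed.

(** The scaling is built on [ncrat_repr f], so transitivity is again what reaches points outside the
    domain of that expression. *)
Lemma ncrat_scale_evalE a (f : ncrat C g) n (X : 'I_g -> 'M[C]_n.+1) :
    ncrat_dom (ncrat_scale a f) X -> ncrat_dom f X ->
  ncrat_eval (ncrat_scale a f) X = a *: ncrat_eval f X.
Proof.
case=> r ar Xr [s fs Xs]; rewrite (ncrat_evalE ar Xr) (ncrat_evalE fs Xs).
have [_ {}ar] := ar; rewrite ncrat_reprE in fs; have [_ {}fs] := fs.
have := ncexpr_equiv_trans
  (nondegenerate_scale a (ncrat_repr_nondegenerate f)) (ncexpr_equiv_sym ar)
  (ncexpr_equiv_scale fs).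
by move=> -> //=; rewrite mul_scalar_mx.
Qed.

End Evaluation.

Theorem corollary4p3 (R : realType) (g : nat) (r s : ncrat R[i] g) :
  (forall (n : nat) (X : 'I_g -> 'M[R[i]]_n.+1),
     ncrat_dom r X -> ncrat_dom s X ->
     loewner_le ((ncrat_eval r X)^t* *m ncrat_eval r X)
                ((ncrat_eval s X)^t* *m ncrat_eval s X))
  <-> (exists lambda : R[i], `|lambda| <= 1 /\ r = ncrat_scale lambda s).
Proof.
split=> [le_rs | [a [a1 ->]] n X Xr Xs]; last first.
  apply/loewner_le_gram => v; rewrite ncrat_scale_evalE // -scalemxAl normsqZ.
  by rewrite ler_piMl ?normsq_ge0 // expr_le1.
(* The points where both chosen representatives are defined suffice to find the factor. Equality of
   classes then extends the relation to all representatives. *)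
have [n X w Xr Xs | a [a1 ra]] :=
    @ncexpr_normsq_le _ _ (ncrat_repr r) (ncrat_repr s).
  have := le_rs n X (ex_intro2 _ _ _ (ncrat_repr_rep r) Xr)
    (ex_intro2 _ _ _ (ncrat_repr_rep s) Xs).
  rewrite (ncrat_evalE (ncrat_repr_rep r) Xr) (ncrat_evalE (ncrat_repr_rep s) Xs).
  by move/loewner_le_gram.
exists a; split=> //; apply: ncrat_eq; rewrite ncrat_reprE.
apply: ncexpr_class_eq ra; first exact: ncrat_repr_nondegenerate.
exact/nondegenerate_scale/ncrat_repr_nondegenerate.
Qed.
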